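(* The categories ${}^{01}\!\mathbf{\Delta}$ and ${}^{0}\!\mathbf{\Delta}C$ are isomorphic to $\mathbf{\Delta}^{op}$.
   Context: $\mathbf{\Delta}$ is the category of finite nonempty totally ordered sets and order-preserving (weakly monotone) maps. ${}^{01}\!\mathbf{\Delta}$ is the category whose objects are finite totally ordered sets with a minimal element $0$ and a maximal element $1$, $0\neq 1$ (so the sets have cardinality at least $2$), and whose morphisms are the order-preserving maps preserving both the minimal and the maximal element. $\mathbf{\Delta}C$ (Connes' cyclic category) has as objects the finite nonempty cyclically ordered sets. A morphism $S\to T$ is an order-preserving map $f:S\to T$ together with a linear ordering of each fiber $f^{-1}(t)$, $t\in T$; that is, the given cyclic order of $S$ is the one obtained by concatenating the linearly ordered fibers $f^{-1}(t)$ in the cyclic order of $T$. (Some fibers may be empty.) In the composite of $f:S\to T$ and $g:T\to U$ the fiber $(gf)^{-1}(u)$ is ordered by concatenating the ordered fibers $f^{-1}(t)$, $t\in g^{-1}(u)$, in the linear order of $g^{-1}(u)$. ${}^{0}\!\mathbf{\Delta}C$ is the category of finite cyclically ordered sets with a chosen basepoint $0$, with morphisms the morphisms of $\mathbf{\Delta}C$ whose underlying map preserves the basepoint. *)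

(* Defs.v *)
From HB Require Import structures.
From mathcomp Require Import all_boot finmap.
From mathcomp Require Import boolp classical_sets functions cardinality.

Set Implicit Arguments.
Unset Strict Implicit.
Unset Printing Implicit Defensive.

Record category := Category {
  ob : Type;
  hom : ob -> ob -> Type;
  idm : forall X, hom X X;
  comp : forall X Y Z, hom Y Z -> hom X Y -> hom X Z;
  comp_idl : forall X Y (f : hom X Y), comp (idm Y) f = f;
  comp_idr : forall X Y (f : hom X Y), comp f (idm X) = f;
  comp_assoc : forall W X Y Z (h : hom Y Z) (g : hom X Y) (f : hom W X),
    comp h (comp g f) = comp (comp h g) f
}.
Arguments hom : clear implicits.
Arguments idm : clear implicits.
Arguments comp {c X Y Z}.

Definition op (C : category) : category :=
  @Category (ob C) (fun X Y => hom C Y X) (idm C)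
    (fun X Y Z g f => comp f g)
    (fun X Y f => comp_idr f) (fun X Y f => comp_idl f)
    (fun W X Y Z h g f => esym (comp_assoc f g h)).

Record functor (C D : category) := Functor {
  fob :> ob C -> ob D;
  fmap : forall X Y, hom C X Y -> hom D (fob X) (fob Y);
  fmap_id : forall X, fmap (idm C X) = idm D (fob X);
  fmap_comp : forall X Y Z (g : hom C Y Z) (f : hom C X Y),
    fmap (comp g f) = comp (fmap g) (fmap f)
}.
Arguments fmap {C D} _ {X Y} _.

Definition functor_id (C : category) : functor C C :=
  @Functor C C id (fun X Y f => f) (fun X => erefl) (fun X Y Z g f => erefl).

Lemma fcomp_id (C D E : category) (G : functor D E) (F : functor C D) X :
  fmap G (fmap F (idm C X)) = idm E (G (F X)).
Proof. by rewrite !fmap_id. Qed.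

Lemma fcomp_comp (C D E : category) (G : functor D E) (F : functor C D)
    X Y Z (g : hom C Y Z) (f : hom C X Y) :
  fmap G (fmap F (comp g f)) = comp (fmap G (fmap F g)) (fmap G (fmap F f)).
Proof. by rewrite !fmap_comp. Qed.

Definition functor_comp (C D E : category) (G : functor D E) (F : functor C D) :
    functor C E :=
  @Functor C E (fun X => G (F X)) (fun X Y f => fmap G (fmap F f))
    (fcomp_id G F) (fcomp_comp G F).

Definition isomorphic (C D : category) : Prop :=
  exists (F : functor C D) (G : functor D C),
    functor_comp G F = functor_id C /\ functor_comp F G = functor_id D.

Definition naturally_isomorphic (C D : category) (F G : functor C D) : Prop :=
  exists (a : forall X, hom D (F X) (G X)) (b : forall X, hom D (G X) (F X)),
    [/\ forall X, comp (b X) (a X) = idm D (F X),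
        forall X, comp (a X) (b X) = idm D (G X)
      & forall X Y (f : hom C X Y),
          comp (a Y) (fmap F f) = comp (fmap G f) (a X)].

Definition equivalent (C D : category) : Prop :=
  exists (F : functor C D) (G : functor D C),
    naturally_isomorphic (functor_comp G F) (functor_id C) /\
    naturally_isomorphic (functor_comp F G) (functor_id D).

(* Each category below is built over a family of finite sets.  With
  [all_finite_sets] the carriers are arbitrary finite types; in that case
  equality of objects involves equality of types, and the isomorphism of
  categories can only be expressed up to natural isomorphism.  With
  [finite_subsets U] the carriers are the finite subsets of [U], so that
  objects can be compared as in set theory and a strict isomorphism makes
  sense. *)

Record finite_sets := FiniteSets {
  code : Type;
  elem :> code -> finType
}.

Definition all_finite_sets : finite_sets := @FiniteSets finType id.

Definition finite_subsets (U : choiceType) : finite_sets :=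
  @FiniteSets {fset U} (fun A => fset_sub_type A : finType).

Section Linear.
Variable V : finite_sets.

Record finord := FinOrd {
  carrier : code V;
  le : rel (V carrier);
  le_refl : reflexive le;
  le_anti : antisymmetric le;
  le_trans : transitive le;
  le_total : total le
}.

Record monotone (S T : finord) := Monotone {
  monotone_fun :> V (carrier S) -> V (carrier T);
  monotoneP : {homo monotone_fun : x y / le x y}
}.

Lemma monotone_eq (S T : finord) (f g : monotone S T) :
  monotone_fun f = monotone_fun g -> f = g.
Proof.
by case: f g => [f fP] [g gP] /= e; subst g; rewrite (Prop_irrelevance fP gP).
Qed.

Definition monotone_id (S : finord) : monotone S S :=
  @Monotone S S id (fun x y xy => xy).

Definition monotone_comp (S T W : finord) (g : monotone T W) (f : monotone S T) :
    monotone S W :=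
  @Monotone S W (fun x => g (f x)) (fun x y xy => monotoneP g (monotoneP f xy)).

Record Delta_ob := DeltaOb {
  Delta_ord :> finord;
  Delta_nonempty : 0 < #|V (carrier Delta_ord)|
}.

Lemma monotone_idl S T (f : monotone S T) : monotone_comp (monotone_id T) f = f.
Proof. exact: monotone_eq. Qed.

Lemma monotone_idr S T (f : monotone S T) : monotone_comp f (monotone_id S) = f.
Proof. exact: monotone_eq. Qed.

Lemma monotone_assoc R S T W
    (h : monotone T W) (g : monotone S T) (f : monotone R S) :
  monotone_comp h (monotone_comp g f) = monotone_comp (monotone_comp h g) f.
Proof. exact: monotone_eq. Qed.

Definition Delta : category :=
  @Category Delta_ob (fun S T => monotone S T)
    (fun S => monotone_id S) (fun S T W g f => monotone_comp g f)
    (fun S T f => monotone_idl f) (fun S T f => monotone_idr f)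
    (fun R S T W h g f => monotone_assoc h g f).

Record Delta01_ob := Delta01Ob {
  Delta01_ord :> finord;
  pt0 : V (carrier Delta01_ord);
  pt1 : V (carrier Delta01_ord);
  pt0_min : forall x, le pt0 x;
  pt1_max : forall x, le x pt1;
  pt01_neq : pt0 <> pt1
}.

Record Delta01_hom (S T : Delta01_ob) := Delta01Hom {
  Delta01_fun :> monotone S T;
  Delta01_fun0 : Delta01_fun (pt0 S) = pt0 T;
  Delta01_fun1 : Delta01_fun (pt1 S) = pt1 T
}.

Lemma Delta01_hom_eq S T (f g : Delta01_hom S T) :
  Delta01_fun f = Delta01_fun g -> f = g.
Proof.
case: f g => [f f0 f1] [g g0 g1] /= e; subst g.
by rewrite (Prop_irrelevance f0 g0) (Prop_irrelevance f1 g1).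
Qed.

Definition Delta01_id (S : Delta01_ob) : Delta01_hom S S :=
  @Delta01Hom S S (monotone_id S) erefl erefl.

Definition Delta01_comp (S T W : Delta01_ob)
    (g : Delta01_hom T W) (f : Delta01_hom S T) : Delta01_hom S W :=
  @Delta01Hom S W (monotone_comp g f)
    (etrans (congr1 g (Delta01_fun0 f)) (Delta01_fun0 g))
    (etrans (congr1 g (Delta01_fun1 f)) (Delta01_fun1 g)).

Lemma Delta01_idl S T (f : Delta01_hom S T) : Delta01_comp (Delta01_id T) f = f.
Proof. by apply: Delta01_hom_eq; apply: monotone_eq. Qed.

Lemma Delta01_idr S T (f : Delta01_hom S T) : Delta01_comp f (Delta01_id S) = f.
Proof. by apply: Delta01_hom_eq; apply: monotone_eq. Qed.

Lemma Delta01_assoc R S T W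
    (h : Delta01_hom T W) (g : Delta01_hom S T) (f : Delta01_hom R S) :
  Delta01_comp h (Delta01_comp g f) = Delta01_comp (Delta01_comp h g) f.
Proof. by apply: Delta01_hom_eq; apply: monotone_eq. Qed.

Definition Delta01 : category :=
  @Category Delta01_ob Delta01_hom Delta01_id Delta01_comp
    Delta01_idl Delta01_idr Delta01_assoc.

End Linear.

Section Cyclic.
Variable V : finite_sets.

(* [cyc x y z] means that x, y, z are pairwise distinct and are met in this
   order when going around; distinctness follows from [cyc_rot] and
   [cyc_asym]. *)
Record fincyc := FinCyc {
  ccarrier : code V;
  cyc : V ccarrier -> V ccarrier -> V ccarrier -> bool;
  cyc_rot : forall x y z, cyc x y z -> cyc y z x;
  cyc_asym : forall x y z, cyc x y z -> ~~ cyc x z y;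
  cyc_trans : forall x y z t, cyc x y z -> cyc x z t -> cyc x y t;
  cyc_total : forall x y z,
    x != y -> y != z -> z != x -> cyc x y z || cyc x z y
}.

(* The ternary relation on S obtained by concatenating the fibers of f, each
   ordered by r, in the cyclic order c of the target.  Here r relates only
   elements of a common fiber. *)
Definition concat_cyc (S T : finType) (c : T -> T -> T -> bool)
    (f : S -> T) (r : rel S) (x y z : S) : bool :=
  let lt a b := (a != b) && r a b in
  [|| c (f x) (f y) (f z),
      lt x y && (f z != f x), lt y z && (f x != f y), lt z x && (f y != f z),
      lt x y && lt y z, lt y z && lt z x | lt z x && lt x y].

(* The linear orders of the fibers are given together as one relation
   [fle] on the source, which relates only elements of a common fiber. *)
Record cyc_map (S T : fincyc) := CycMap {
  cyc_fun :> V (ccarrier S) -> V (ccarrier T);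
  fle : rel (V (ccarrier S));
  fle_fiber : forall x y, fle x y -> cyc_fun x = cyc_fun y;
  fle_refl : reflexive fle;
  fle_anti : antisymmetric fle;
  fle_trans : transitive fle;
  fle_total : forall x y, cyc_fun x = cyc_fun y -> fle x y || fle y x;
  cyc_concat : forall x y z, cyc x y z = concat_cyc (@cyc T) cyc_fun fle x y z
}.

Lemma cyc_map_eq S T (f g : cyc_map S T) :
  cyc_fun f = cyc_fun g -> fle f = fle g -> f = g.
Proof.
case: f g => [f r a1 a2 a3 a4 a5 a6] [g s b1 b2 b3 b4 b5 b6] /= e1 e2; subst g s.
by congr CycMap; apply: Prop_irrelevance.
Qed.

Lemma cyc_neq (S : fincyc) (x y z : V (ccarrier S)) :
  cyc x y z -> [/\ x != y, y != z & z != x].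
Proof.
have neq a b c : cyc a b c -> b != c :> V (ccarrier S).
  by move=> abc; apply/eqP => e; subst c; move/cyc_asym: (abc); rewrite abc.
move=> xyz; split; last 2 first.
- exact: neq xyz.
- exact: neq (cyc_rot xyz).
- exact: neq (cyc_rot (cyc_rot xyz)).
Qed.

Definition cyc_map_id (S : fincyc) : cyc_map S S.
Proof.
refine (@CycMap S S id (fun x y => x == y) _ _ _ _ _ _).
- by move=> x y /eqP.
- by move=> x /=.
- by move=> x y /andP[/eqP].
- by move=> y x z /eqP-> /eqP->.
- by move=> x y ->; rewrite eqxx.
- by move=> x y z; rewrite /concat_cyc /= !andNb /= !orbF.
Defined.

Definition comp_fle (S T : finType) (f : S -> T) (r : rel S) (s : rel T) : rel S :=
  fun x y => if f x == f y then r x y else s (f x) (f y).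

Lemma concat_comp (S T W : fincyc) (g : cyc_map T W) (f : cyc_map S T) x y z :
  cyc x y z =
  concat_cyc (@cyc W) (fun x => g (f x)) (comp_fle f (fle f) (fle g)) x y z.
Proof.
have cycF1 (A : fincyc) (a c : V (ccarrier A)) : cyc a a c = false.
  by apply/negP => /cyc_neq[]; rewrite eqxx.
have cycF2 (A : fincyc) (a c : V (ccarrier A)) : cyc a c c = false.
  by apply/negP => /cyc_neq[_]; rewrite eqxx.
have cycF3 (A : fincyc) (a c : V (ccarrier A)) : cyc a c a = false.
  by apply/negP => /cyc_neq[_ _]; rewrite eqxx.
have fleF u v : f u != f v -> fle f u v = false.
  by move=> uv; apply/negP => /fle_fiber e; rewrite e eqxx in uv.
have neF u v : f u != f v -> (u == v) = false.
  by move=> uv; apply: contra_neqF uv => /eqP->.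
have key a b : a != b -> [/\ fle g a b && fle g b a = false,
    [|| g a != g b, fle g a b | fle g b a],
    fle g a b ==> (g a == g b) & fle g b a ==> (g a == g b)].
  move=> ab; split.
  - by apply/negP => /fle_anti e; rewrite e eqxx in ab.
  - by case: eqP => // e; apply: fle_total.
  - by apply/implyP => /fle_fiber->.
  - by apply/implyP => /fle_fiber->.
rewrite (cyc_concat f) /concat_cyc /comp_fle.
have [exy|nxy] := eqVneq (f x) (f y); have [eyz|nyz] := eqVneq (f y) (f z);
  have [ezx|nzx] := eqVneq (f z) (f x).
- by rewrite exy eyz !cycF1 eqxx.
- by rewrite -eyz exy eqxx in nzx.
- by rewrite -exy ezx eqxx in nyz.
- have nzy : f z != f y by rewrite eq_sym.
  have [k1 k2 k3 k4] := key _ _ nzy.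
  rewrite exy !cycF1 eqxx (fleF y z) // (fleF z x) // (neF y z) // (neF z x) //.
  rewrite ?(negbTE nyz) ?(negbTE nzy) /= ?andbF ?andbT ?orbF.
  rewrite ?[g (f y) == g (f z)]eq_sym.
  by move: k1 k2 k3 k4; do ![case: (_ == _) | case: (fle _ _ _)].
- by rewrite -ezx eyz eqxx in nxy.
- have [k1 k2 k3 k4] := key _ _ nxy.
  rewrite -eyz !cycF2 eqxx (fleF x y) // (fleF z x) // (neF x y) // (neF z x) //.
  rewrite ?[f y == f x]eq_sym ?(negbTE nxy) /= ?andbF ?andbT ?orbF.
  rewrite ?[g (f y) == g (f x)]eq_sym.
  by move: k1 k2 k3 k4; do ![case: (_ == _) | case: (fle _ _ _)].
- have [k1 k2 k3 k4] := key _ _ nxy.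
  rewrite ezx !cycF3 eqxx (fleF x y) // (fleF y z) // (neF x y) // (neF y z) //.
  rewrite ?[f y == f x]eq_sym ?(negbTE nxy) /= ?andbF ?andbT ?orbF.
  rewrite ?[g (f y) == g (f x)]eq_sym.
  by move: k1 k2 k3 k4; do ![case: (_ == _) | case: (fle _ _ _)].
- rewrite (cyc_concat g) /concat_cyc (neF x y) // (neF y z) // (neF z x) //.
  rewrite (fleF x y) // (fleF y z) // (fleF z x) //.
  by rewrite nxy nyz nzx /= !orbF.
Qed.

Definition cyc_map_comp (S T W : fincyc) (g : cyc_map T W) (f : cyc_map S T) :
  cyc_map S W.
Proof.
refine (@CycMap S W (fun x => g (f x)) (comp_fle f (fle f) (fle g))
  _ _ _ _ _ (concat_comp g f)); rewrite /comp_fle.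
- by move=> x y; case: eqP => [->//|_] /fle_fiber.
- by move=> x; rewrite eqxx fle_refl.
- move=> x y; rewrite [f y == f x]eq_sym; case: eqP => [_|ne]; first exact: fle_anti.
  by move=> /fle_anti.
- move=> y x z; case: (f x =P f y) => [exy|nxy]; case: (f y =P f z) => [eyz|nyz].
  + by rewrite exy eyz eqxx; apply: fle_trans.
  + by rewrite exy; case: eqP nyz.
  + by rewrite -eyz; case: eqP nxy.
  + move=> xy yz; case: eqP => [exz|_]; last exact: fle_trans xy yz.
    by case: nxy; apply: (@fle_anti _ _ g); rewrite xy exz yz.
- move=> x y; rewrite [f y == f x]eq_sym; case: eqP => [e _|_]; first exact: fle_total e.
  exact: fle_total.
Defined.

Lemma cyc_map_idl S T (f : cyc_map S T) : cyc_map_comp (cyc_map_id T) f = f.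
Proof.
apply: cyc_map_eq => //=; apply/funext => x; apply/funext => y.
rewrite /comp_fle; case: eqP => // ne; apply/esym/negP => /fle_fiber.
exact: ne.
Qed.

Lemma cyc_map_idr S T (f : cyc_map S T) : cyc_map_comp f (cyc_map_id S) = f.
Proof.
apply: cyc_map_eq => //=; apply/funext => x; apply/funext => y.
by rewrite /comp_fle; case: eqP => // ->; rewrite fle_refl.
Qed.

Lemma cyc_map_assoc R S T W
    (h : cyc_map T W) (g : cyc_map S T) (f : cyc_map R S) :
  cyc_map_comp h (cyc_map_comp g f) = cyc_map_comp (cyc_map_comp h g) f.
Proof.
apply: cyc_map_eq => //=; apply/funext => x; apply/funext => y.
by rewrite /comp_fle; case: (f x =P f y) => [->|//]; rewrite eqxx.
Qed.

Record DeltaC_ob := DeltaCOb {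
  DeltaC_cyc :> fincyc;
  DeltaC_nonempty : 0 < #|V (ccarrier DeltaC_cyc)|
}.

Definition DeltaC : category :=
  @Category DeltaC_ob (fun S T => cyc_map S T)
    (fun S => cyc_map_id S) (fun S T W g f => cyc_map_comp g f)
    (fun S T f => cyc_map_idl f) (fun S T f => cyc_map_idr f)
    (fun R S T W h g f => cyc_map_assoc h g f).

Record Delta0C_ob := Delta0COb {
  Delta0C_cyc :> ob DeltaC;
  base : V (ccarrier Delta0C_cyc)
}.

Record Delta0C_hom (S T : Delta0C_ob) := Delta0CHom {
  Delta0C_map :> hom DeltaC S T;
  Delta0C_base : cyc_fun Delta0C_map (base S) = base T
}.

Lemma Delta0C_hom_eq S T (f g : Delta0C_hom S T) :
  Delta0C_map f = Delta0C_map g -> f = g.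
Proof.
by case: f g => [f f0] [g g0] /= e; subst g; rewrite (Prop_irrelevance f0 g0).
Qed.

Definition Delta0C_id (S : Delta0C_ob) : Delta0C_hom S S :=
  @Delta0CHom S S (idm DeltaC S) erefl.

Definition Delta0C_comp (S T W : Delta0C_ob)
    (g : Delta0C_hom T W) (f : Delta0C_hom S T) : Delta0C_hom S W :=
  @Delta0CHom S W (comp (Delta0C_map g) (Delta0C_map f))
    (etrans (congr1 (cyc_fun (Delta0C_map g)) (Delta0C_base f))
      (Delta0C_base g)).

Lemma Delta0C_idl S T (f : Delta0C_hom S T) : Delta0C_comp (Delta0C_id T) f = f.
Proof. by apply: Delta0C_hom_eq; apply: comp_idl. Qed.

Lemma Delta0C_idr S T (f : Delta0C_hom S T) : Delta0C_comp f (Delta0C_id S) = f.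
Proof. by apply: Delta0C_hom_eq; apply: comp_idr. Qed.

Lemma Delta0C_assoc R S T W
    (h : Delta0C_hom T W) (g : Delta0C_hom S T) (f : Delta0C_hom R S) :
  Delta0C_comp h (Delta0C_comp g f) = Delta0C_comp (Delta0C_comp h g) f.
Proof. by apply: Delta0C_hom_eq; apply: comp_assoc. Qed.

Definition Delta0C : category :=
  @Category Delta0C_ob Delta0C_hom Delta0C_id Delta0C_comp
    Delta0C_idl Delta0C_idr Delta0C_assoc.

End Cyclic.

(* Main.v *)
(* A morphism of any of the three categories is determined by a monotone map
   {0, ..., m+1} -> {0, ..., n+1} preserving both ends, where m and n only depend
   on the cardinals of the source and of the target:
   - in 01Delta, transport the map along the unique orders;
   - in Delta^op, a monotone map f : [n] -> [m] is dual to the map of cuts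
     i |-> #{y | f y < i};
   - in 0DeltaC, cut the source and the target at the base point and unroll: the
     elements of the fiber over the base point which precede the base point are
     sent to n+1, and all others are sent to the position of their image.
   These encodings are compatible with composition and hit every end-preserving
   map, so equivalences reduce to matching cardinals, and isomorphisms to
   bijections between objects that match cardinals. A pointed cyclic order is
   the same as a nonempty linear order on the same set. For 01Delta over the
   finite subsets of an infinite U, one must match the linearly ordered subsets
   with n+2 elements with those with n+1 elements; this follows from
   Cantor-Bernstein and an injection U * U -> U (Hessenberg's theorem). *)
Require Import Defs.
From mathcomp Require Import all_boot finmap.
From mathcomp Require Import boolp classical_sets functions cardinality.
From mathcomp Require Import zify.

Set Implicit Arguments.
Unset Strict Implicit.
Unset Printing Implicit Defensive.

(** * Categories coded by end-preserving maps *)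

(* An end-preserving map {0, ..., m+1} -> {0, ..., n+1}, extended to nat by the
   constant n+1. *)
Definition end_preserving (m n : nat) (g : nat -> nat) : Prop :=
  [/\ {homo g : i j / i <= j}, g 0 = 0 & forall i, m < i -> g i = n.+1].

Lemma end_preserving_ub m n g i : end_preserving m n g -> g i <= n.+1.
Proof.
case=> homo_g _ g_const; rewrite -(g_const (maxn i m.+1)) ?leq_maxr //.
exact/homo_g/leq_maxl.
Qed.

(* The codes are untyped so that equations between morphisms never involve
   transport along equalities of objects. *)
Record coding (C : category) := Coding {
  rank : ob C -> nat;
  enc : forall X Y, hom C X Y -> nat -> nat;
  enc_inj : forall X Y, injective (@enc X Y);
  encP : forall X Y (f : hom C X Y), end_preserving (rank X) (rank Y) (enc f);
  enc_surj : forall X Y g,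
    end_preserving (rank X) (rank Y) g -> exists f : hom C X Y, enc f = g;
  enc_id : forall X, enc (idm C X) = minn^~ (rank X).+1;
  enc_comp : forall X Y Z (g : hom C Y Z) (f : hom C X Y),
    enc (Defs.comp g f) = enc g \o enc f
}.
Arguments enc {C} c {X Y} f.

(** Codes can be compared before [F X = X] is rewritten. Once the object map has been replaced by
    the identity, [enc_inj] identifies the morphism maps. *)
Lemma functor_eq_id (C : category) (c : coding C) (F : functor C C) :
  (forall X, F X = X) -> (forall X Y (f : hom C X Y), enc c (fmap F f) = enc c f) ->
  F = functor_id C.
Proof.
case: F => F0 F1 F1id F1comp /= obF encF.
have /funext e : F0 =1 id by [].
subst F0.
have e : F1 = fun X Y f => f.
  apply/functional_extensionality_dep => X; apply/functional_extensionality_dep => Y.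
  by apply/funext => f; apply: (@enc_inj _ c); apply: encF.
subst F1; rewrite /functor_id; congr Functor; exact: Prop_irrelevance.
Qed.

Section Coded.
Variables (C D : category) (c : coding C) (d : coding D).
Variables (phi : ob C -> ob D).
Hypothesis rank_phi : forall X, rank d (phi X) = rank c X.

Lemma transport_subproof X Y (f : hom C X Y) :
  exists f' : hom D (phi X) (phi Y), enc d f' = enc c f.
Proof. by apply: enc_surj; rewrite !rank_phi; apply: encP. Qed.

(** The choice is harmless: by [enc_inj] a morphism is determined by its code, and functoriality
    follows by comparing codes. *)
Definition transport X Y (f : hom C X Y) : hom D (phi X) (phi Y) :=
  sval (cid (transport_subproof f)).

Lemma enc_transport X Y (f : hom C X Y) : enc d (transport f) = enc c f.
Proof. exact: svalP (cid (transport_subproof f)). Qed.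

Lemma transport_id X : transport (idm C X) = idm D (phi X).
Proof. by apply: (@enc_inj _ d); rewrite enc_transport !enc_id rank_phi. Qed.

Lemma transport_comp X Y Z (g : hom C Y Z) (f : hom C X Y) :
  transport (Defs.comp g f) = Defs.comp (transport g) (transport f).
Proof.
by apply: (@enc_inj _ d); rewrite enc_comp !enc_transport enc_comp.
Qed.

Definition transport_functor : functor C D := Functor transport_id transport_comp.

End Coded.

(** The components are the morphisms with the same code as an identity, which [enc_surj] provides in
    both directions. *)
Lemma coded_nat_iso_id (C : category) (c : coding C) (F : functor C C) :
  (forall X, rank c (F X) = rank c X) ->
  (forall X Y (f : hom C X Y), enc c (fmap F f) = enc c f) ->
  naturally_isomorphic F (functor_id C).
Proof.
move=> rankF encF.
have ex X Y : rank c X = rank c Y ->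
    exists f : hom C X Y, enc c f = minn^~ (rank c X).+1.
  by move=> e; apply: enc_surj; rewrite -e -(enc_id c); apply: encP.
pose a X := sval (cid (ex (F X) X (rankF X))).
pose b X := sval (cid (ex X (F X) (esym (rankF X)))).
have aE X : enc c (a X) = minn^~ (rank c X).+1.
  by rewrite /a; case: cid => f /= ->; rewrite rankF.
have bE X : enc c (b X) = minn^~ (rank c X).+1 by rewrite /b; case: cid.
have minK n : minn^~ n \o minn^~ n = minn^~ n.
  by apply/funext => i /=; rewrite -minnA minnn.
exists a, b; split=> [X|X|X Y f]; apply: (@enc_inj _ c).
- by rewrite enc_comp aE bE enc_id rankF minK.
- by rewrite enc_comp aE bE enc_id minK.
- rewrite !enc_comp !aE encF /=; apply/funext => i /=.
  (* Naturality: truncating after [enc f] changes nothing because its values never exceed the top,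
     and truncating before it changes nothing because [enc f] is constant from the top on. *)
  have fP := encP c f; rewrite (minn_idPl (end_preserving_ub _ fP)).
  case: fP => _ _ fP.
  case: (leqP i (rank c X).+1) => // h.
  by rewrite !fP // ltnW.
Qed.

Lemma coded_equivalent (C D : category) (c : coding C) (d : coding D)
    (phi : ob C -> ob D) (psi : ob D -> ob C) :
  (forall X, rank d (phi X) = rank c X) -> (forall Y, rank c (psi Y) = rank d Y) ->
  equivalent C D.
Proof.
move=> phiP psiP; exists (transport_functor phiP), (transport_functor psiP).
split; [apply: (@coded_nat_iso_id _ c) | apply: (@coded_nat_iso_id _ d)] => * /=;
  by rewrite ?psiP ?phiP ?enc_transport.
Qed.

Lemma coded_isomorphic (C D : category) (c : coding C) (d : coding D)
    (phi : ob C -> ob D) (psi : ob D -> ob C) :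
  cancel phi psi -> cancel psi phi -> (forall X, rank d (phi X) = rank c X) ->
  isomorphic C D.
Proof.
move=> phiK psiK phiP.
have psiP Y : rank c (psi Y) = rank d Y by rewrite -phiP psiK.
exists (transport_functor phiP), (transport_functor psiP).
by split; [apply: (@functor_eq_id _ c) | apply: (@functor_eq_id _ d)] => * /=;
  rewrite ?psiK ?phiK ?enc_transport.
Qed.

(** * Positions in a finite linear order *)

Section Position.
Variables (V : finite_sets) (S : finord V).
Local Notation T := (V (carrier S)).
Implicit Types (x y : T) (k : nat).

Definition pos x : nat := #|[pred y | (y != x) && le y x]|.

Lemma le_pos x y : le x y = (pos x <= pos y).
Proof.
(* The strict predecessors of [u], and [u] itself, are strict predecessors of [v]. *)
have lt_pos u v : ~~ le v u -> pos u < pos v.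
  move=> nvu; have uv : le u v by have := le_total u v; rewrite (negbTE nvu) orbF.
  apply: proper_card; apply/properP; split; last first.
    exists u; rewrite !inE ?eqxx // uv andbT.
    by apply: contra nvu => /eqP->; apply: le_refl.
  apply/fintype.subsetP => w; rewrite !inE => /andP[nwu wu].
  rewrite (le_trans wu uv) andbT; by apply: contra nvu => /eqP <-.
apply/idP/idP => [xy|]; last by apply: contraTT => /lt_pos; rewrite ltnNge.
apply: subset_leq_card; apply/fintype.subsetP => w; rewrite !inE => /andP[nwx wx].
rewrite (le_trans wx xy) andbT; apply: contra nwx => /eqP e; subst w.
by apply/eqP; apply: (@le_anti _ S); rewrite wx xy.
Qed.

Lemma pos_inj : injective pos.
Proof. by move=> x y e; apply: (@le_anti _ S); rewrite !le_pos e leqnn. Qed.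

Lemma pos_eq x y : (x == y) = (pos x == pos y).
Proof. by rewrite (inj_eq pos_inj). Qed.

Lemma pos_lt x : pos x < #|T|.
Proof.
rewrite -cardsT; apply: proper_card; apply/properP; split.
  by apply/fintype.subsetP => y _; rewrite finset.in_setT.
by exists x; rewrite ?finset.in_setT // inE eqxx.
Qed.

(** If [x] is in [D], its strict predecessors lie in [D] without [x]; otherwise all of [D] lies
    among them. *)
Lemma pos_downset (D : {pred T}) :
  (forall x y, le x y -> y \in D -> x \in D) -> forall x, (x \in D) = (pos x < #|D|).
Proof.
move=> downD x; apply/idP/idP => [xD|].
  apply: proper_card; apply/properP; split.
    by apply/fintype.subsetP => y; rewrite inE => /andP[_ yx]; apply: downD yx xD.
  by exists x; rewrite // inE eqxx.
apply: contraTT => xD; rewrite -leqNgt; apply: subset_leq_card.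
apply/fintype.subsetP => y yD; rewrite inE.
have nyx : ~~ le x y by apply: contra xD => xy; apply: downD xy yD.
apply/andP; split; first by apply: contraNneq xD => <-.
by have := le_total x y; rewrite (negbTE nyx).
Qed.

Lemma pos_surj k : k < #|T| -> exists x, pos x = k.
Proof.
move=> kT; pose f x := Ordinal (pos_lt x).
have f_inj : injective f by move=> x y [] /pos_inj.
have [|g fK gK] := inj_card_bij f_inj; first by rewrite card_ord.
by exists (g (Ordinal kT)); have /(congr1 val) := gK (Ordinal kT).
Qed.

(* A junk value [x0] is returned beyond the cardinal. *)
Definition at_pos x0 k : T := odflt x0 [pick x | pos x == k].

Lemma at_posK x0 k : k < #|T| -> pos (at_pos x0 k) = k.
Proof.
move=> /pos_surj[x xk]; rewrite /at_pos; case: pickP => [y /eqP//|/(_ x)].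
by rewrite xk eqxx.
Qed.

Lemma pos_atK x0 x : at_pos x0 (pos x) = x.
Proof. by apply: pos_inj; rewrite at_posK ?pos_lt. Qed.

Lemma card_pos_lt k : #|[pred x | pos x < k]| = minn k #|T|.
Proof.
(* This set is a down-set, so its own cardinal tests membership as well as [k] does. If the cardinal
   were not the minimum, an element at the smaller position would separate the two tests. *)
have D x : (pos x < k) = (pos x < #|[pred x | pos x < k]|).
  rewrite -pos_downset // => y z; rewrite le_pos !inE; exact: leq_ltn_trans.
have DT : #|[pred x | pos x < k]| <= #|T| by apply: max_card.
move: D DT; set n := #|_| => D nT.
apply/eqP; rewrite eqn_leq leq_min nT andbT; apply/andP; split.
  rewrite leqNgt; apply/negP => kn.
  have [x xk] := pos_surj (leq_trans kn nT).
  by have := D x; rewrite xk kn ltnn.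
rewrite leqNgt; apply/negP; rewrite leq_min => /andP[nk nT'].
have [x xn] := pos_surj nT'.
by have := D x; rewrite xn nk ltnn.
Qed.

End Position.

(** * Coding of the opposite of Delta by cuts *)

Section DeltaCoding.
Variable V : finite_sets.
Implicit Types X Y Z : Delta_ob V.

Definition Delta_rank X := #|V (carrier X)|.-1.

Lemma Delta_rankS X : (Delta_rank X).+1 = #|V (carrier X)|.
Proof. by rewrite /Delta_rank prednK // Delta_nonempty. Qed.

Definition Delta_enc X Y (f : monotone Y X) (i : nat) : nat :=
  #|[pred y | pos (f y) < i]|.

(** The [y] with [pos (f y) < i] form a down-set because [f] is monotone. This adjunction lets [f]
    and its code determine each other, and it reverses composition. *)
Lemma Delta_enc_lt X Y (f : monotone Y X) i y :
  (pos y < Delta_enc f i) = (pos (f y) < i).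
Proof.
rewrite -pos_downset // => x z xz; rewrite !inE; apply: leq_ltn_trans.
by rewrite -le_pos; apply: monotoneP.
Qed.

Lemma Delta_enc_inj X Y : injective (@Delta_enc X Y).
Proof.
move=> f g e; apply: monotone_eq; apply/funext => y; apply: pos_inj.
have lt i : (pos (f y) < i) = (pos (g y) < i) by rewrite -!Delta_enc_lt e.
by have := lt (pos (f y)); have := lt (pos (g y)); rewrite !ltnn; case: ltngtP.
Qed.

Lemma Delta_encP X Y (f : monotone Y X) :
  end_preserving (Delta_rank X) (Delta_rank Y) (Delta_enc f).
Proof.
split=> [i j ij| |i Xi].
- apply: subset_leq_card; apply/fintype.subsetP => y; rewrite !inE => yi.
  exact: leq_trans yi ij.
- by apply: eq_card0 => y; rewrite !inE.
- rewrite Delta_rankS; apply: eq_card => y; rewrite !inE.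
  by apply: leq_trans (pos_lt _) _; rewrite -Delta_rankS.
Qed.

Lemma Delta_enc_surj X Y g :
  end_preserving (Delta_rank X) (Delta_rank Y) g ->
  exists f : monotone Y X, Delta_enc f = g.
Proof.
move=> gP; have [g_homo g0 g1] := gP.
have ex (y : V (carrier Y)) : exists i, pos y < g i.
  exists (Delta_rank X).+1; rewrite g1 // Delta_rankS; exact: pos_lt.
have /card_gt0P[x0 _] := Delta_nonempty X.
(* The adjunction forces this position: one less than the least [i] with [pos y < g i]. That [i] is
   positive since [g 0 = 0], and at most the cardinal of [X], where [g] reaches its top. *)
pose f y := at_pos x0 (ex_minn (ex y)).-1.
have fE y i : (pos (f y) < i) = (pos y < g i).
  rewrite /f; case: ex_minnP => [[|k] /= yk kmin]; first by rewrite g0 in yk.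
  rewrite at_posK; last first.
    by apply: kmin; rewrite -Delta_rankS g1 // Delta_rankS pos_lt.
  apply/idP/idP => [ki|/kmin//].
  exact: leq_trans yk (g_homo _ _ ki).
have f_homo : {homo f : x y / le x y}.
  move=> x y; rewrite !le_pos -[pos (f x) <= _]ltnS fE => xy.
  by apply: leq_ltn_trans xy _; rewrite -fE.
exists (Monotone f_homo); apply/funext => i.
have -> : Delta_enc (Monotone f_homo) i = #|[pred y : V (carrier Y) | pos y < g i]|.
  by apply: eq_card => y; rewrite !inE /= fE.
by rewrite card_pos_lt -Delta_rankS; apply/minn_idPl/(end_preserving_ub _ gP).
Qed.

Definition Delta_coding : coding (op (Delta V)).
Proof.
refine (@Coding (op (Delta V)) Delta_rank (fun X Y f => @Delta_enc X Y f)
  Delta_enc_inj Delta_encP Delta_enc_surj _ _).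
- by move=> X; apply/funext => i; rewrite Delta_rankS; apply: card_pos_lt.
- move=> X Y Z g f; apply/funext => i; apply: eq_card => z.
  by rewrite !inE Delta_enc_lt.
Defined.

End DeltaCoding.

(** * Coding of 01Delta *)

Section Delta01Coding.
Variable V : finite_sets.
Implicit Types X Y Z : Delta01_ob V.

Definition Delta01_rank X := #|V (carrier X)|.-2.

Lemma Delta01_rankSS X : (Delta01_rank X).+2 = #|V (carrier X)|.
Proof.
have : 1 < #|V (carrier X)|.
  rewrite (cardD1 (pt0 X)) (cardD1 (pt1 X)) !inE andbT.
  by case: eqVneq => // e; case: (@pt01_neq _ X).
by rewrite /Delta01_rank; case: #|_| => [|[]].
Qed.

Lemma pos_pt0 X : pos (pt0 X) = 0.
Proof.
have [x x0] : exists x : V (carrier X), pos x = 0.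
  by apply: pos_surj; rewrite -Delta01_rankSS.
by apply/eqP; rewrite -leqn0 -x0 -le_pos pt0_min.
Qed.

Lemma pos_pt1 X : pos (pt1 X) = (Delta01_rank X).+1.
Proof.
have [x x1] : exists x : V (carrier X), pos x = (Delta01_rank X).+1.
  by apply: pos_surj; rewrite -Delta01_rankSS.
apply/eqP; rewrite eqn_leq -ltnS Delta01_rankSS pos_lt -x1 -le_pos.
exact: pt1_max.
Qed.

(** The default [pt1 X] makes the code constant, at the top of [Y], beyond the last position of
    [X]. *)
Definition Delta01_enc X Y (f : Delta01_hom X Y) (i : nat) : nat :=
  pos (f (at_pos (pt1 X) i)).

Lemma at_pos_pt1 X i : Delta01_rank X < i -> at_pos (pt1 X) i = pt1 X.
Proof.
rewrite leq_eqVlt => /orP[/eqP<-|Xi]; first by rewrite -pos_pt1 pos_atK.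
rewrite /at_pos; case: pickP => // x /eqP xi.
by have := pos_lt x; rewrite xi -Delta01_rankSS ltnNge Xi.
Qed.

Lemma pos_at_pt1 X i : pos (at_pos (pt1 X) i) = minn i (Delta01_rank X).+1.
Proof.
case: (leqP i (Delta01_rank X).+1) => [iX|Xi].
  by apply: at_posK; rewrite -Delta01_rankSS ltnS.
by rewrite at_pos_pt1 ?pos_pt1 // ltnW.
Qed.

Lemma Delta01_enc_inj X Y : injective (@Delta01_enc X Y).
Proof.
move=> f g e; apply: Delta01_hom_eq; apply: monotone_eq; apply/funext => x.
apply: pos_inj; have /(congr1 (@^~ (pos x))) := e.
by rewrite /Delta01_enc pos_atK.
Qed.

Lemma Delta01_encP X Y (f : Delta01_hom X Y) :
  end_preserving (Delta01_rank X) (Delta01_rank Y) (Delta01_enc f).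
Proof.
split=> [i j ij| |i Xi]; rewrite /Delta01_enc.
- rewrite -le_pos; apply: monotoneP; rewrite le_pos !pos_at_pt1; lia.
- by rewrite -[in at_pos _ _](pos_pt0 X) pos_atK Delta01_fun0 pos_pt0.
- by rewrite at_pos_pt1 // Delta01_fun1 pos_pt1.
Qed.

Lemma Delta01_enc_surj X Y g :
  end_preserving (Delta01_rank X) (Delta01_rank Y) g ->
  exists f : Delta01_hom X Y, Delta01_enc f = g.
Proof.
move=> gP; have [g_homo g0 g1] := gP.
pose f (x : V (carrier X)) := at_pos (pt1 Y) (g (pos x)).
have fE x : pos (f x) = g (pos x).
  by rewrite pos_at_pt1; apply/minn_idPl/(end_preserving_ub _ gP).
have f_homo : {homo f : x y / le x y}.
  by move=> x y; rewrite !le_pos !fE; apply: g_homo.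
have f0 : f (pt0 X) = pt0 Y by apply: pos_inj; rewrite fE !pos_pt0.
have f1 : f (pt1 X) = pt1 Y by apply: pos_inj; rewrite fE !pos_pt1 g1.
exists (@Delta01Hom _ X Y (Monotone f_homo) f0 f1); apply/funext => i.
rewrite /Delta01_enc /= fE pos_at_pt1.
by case: (leqP i (Delta01_rank X).+1) => // Xi; rewrite !g1 // ltnW.
Qed.

Definition Delta01_coding : coding (Delta01 V).
Proof.
refine (@Coding (Delta01 V) Delta01_rank Delta01_enc
  Delta01_enc_inj Delta01_encP Delta01_enc_surj _ _).
- by move=> X; apply/funext => i; rewrite /Delta01_enc pos_at_pt1.
- by move=> X Y Z g f; apply/funext => i; rewrite /Delta01_enc /= pos_atK.
Defined.

End Delta01Coding.

(** * Cutting a cyclic order at a point *)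

Section Cut.
Variables (V : finite_sets) (S : fincyc V) (b : V (ccarrier S)).
Implicit Types x y z : V (ccarrier S).

Lemma cyc_xyy x y : cyc x y y = false.
Proof. by apply/negP => /cyc_neq[_]; rewrite eqxx. Qed.

Lemma cyc_xyx x y : cyc x y x = false.
Proof. by apply/negP => /cyc_neq[_ _]; rewrite eqxx. Qed.

Definition cut_le x y := [|| x == b, x == y | cyc b x y].

Lemma cut_le_refl : reflexive cut_le.
Proof. by move=> x; rewrite /cut_le eqxx orbT. Qed.

Lemma cut_le_anti : antisymmetric cut_le.
Proof.
move=> x y /andP[/or3P[/eqP->|/eqP//|xy]] /or3P[/eqP//|/eqP//|].
- by rewrite cyc_xyx.
- by move=> e; move: xy; rewrite e cyc_xyx.
- by move/cyc_asym; rewrite xy.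
Qed.

Lemma cut_le_trans : transitive cut_le.
Proof.
move=> y x z /or3P[/eqP->|/eqP->//|xy]; first by rewrite /cut_le eqxx.
case/or3P=> [/eqP e|/eqP<-|yz]; last by rewrite /cut_le (cyc_trans xy yz) !orbT.
- by move: xy; rewrite e cyc_xyx.
- by rewrite /cut_le xy !orbT.
Qed.

Lemma cut_le_total : total cut_le.
Proof.
move=> x y; rewrite /cut_le.
case: eqVneq => //= xb; case: (eqVneq x y) => //= xy.
case: (eqVneq y b) => [_|yb] /=; first by rewrite orbT.
apply: cyc_total => //.
by rewrite eq_sym.
Qed.

Definition cut : finord V :=
  FinOrd cut_le_refl cut_le_anti cut_le_trans cut_le_total.

Lemma cut_pos_base : pos (S := cut) b = 0.
Proof.
apply: eq_card0 => y; rewrite !inE /= /cut_le cyc_xyx orbF orbb.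
by case: eqP.
Qed.

Lemma cut_pos_lt x y : pos (S := cut) x < pos (S := cut) y = (x != y) && cut_le x y.
Proof. by rewrite ltn_neqAle -(inj_eq (@pos_inj _ cut)) -(@le_pos _ cut). Qed.

Lemma cyc_of_cut x y z : pos (S := cut) x < pos (S := cut) y ->
  pos (S := cut) y < pos (S := cut) z -> cyc x y z.
Proof.
rewrite !cut_pos_lt /cut_le => /andP[xy]; rewrite (negbTE xy) /= => bxy /andP[yz].
rewrite (negbTE yz) /= => /orP[/eqP e|byz].
  by move: bxy xy; rewrite e cyc_xyx orbF => ->.
case: (eqVneq x b) => [->//|xb]; rewrite (negbTE xb) /= in bxy.
(* Going around from [y], one meets [z] before [b] and [b] before [x]; transitivity drops [b]. *)
exact: cyc_rot (cyc_rot (cyc_trans (cyc_rot byz) (cyc_rot (cyc_rot bxy)))).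
Qed.

Definition pos_cyc (i j k : nat) := [|| i < j < k, j < k < i | k < i < j].

(** Three distinct positions that are not in the cyclic order of [x], [y], [z] are in that of [x],
    [z], [y], which [cyc_asym] excludes. *)
Lemma cyc_pos x y z :
  cyc x y z = pos_cyc (pos (S := cut) x) (pos (S := cut) y) (pos (S := cut) z).
Proof.
have c := cyc_of_cut; apply/idP/idP => [xyz|]; last first.
  by case/or3P => /andP[h1 h2]; [|apply: cyc_rot; apply: cyc_rot|apply: cyc_rot];
    apply: c.
have [xy yz zx] := cyc_neq xyz; have nxzy := cyc_asym xyz.
have {c} := c; rewrite /pos_cyc => c.
move: xy yz zx; rewrite !(@pos_eq _ cut).
case: ltngtP => // xy _; case: ltngtP => // yz _; case: ltngtP => // zx _ //=;
  apply: contraR nxzy => _;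
  solve [lia | by apply: c | by apply: cyc_rot; apply: c
        | by apply: cyc_rot; apply: cyc_rot; apply: c].
Qed.

End Cut.

(** * Unrolling cyclic maps between cut orders *)

Section Lift.
Variables (V : finite_sets) (S T : fincyc V).
Variables (b : V (ccarrier S)) (b' : V (ccarrier T)) (f : cyc_map S T).
Hypothesis fb : f b = b'.
Implicit Types x y z : V (ccarrier S).

(* Cutting S at b splits the fiber over the base point into a final segment of
   S, which comes first in the order of the fiber, and an initial segment
   starting at b; the former is sent to the extra point #|T|. *)
Definition wraps x := (f x == b') && ~~ fle f b x.

Definition lift x : nat :=
  if wraps x then #|V (ccarrier T)| else pos (S := cut b') (f x).

Lemma lift_base : lift b = 0.
Proof. by rewrite /lift /wraps fle_refl andbF fb cut_pos_base. Qed.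

Lemma lift_ub x : lift x <= #|V (ccarrier T)|.
Proof. by rewrite /lift; case: ifP => // _; apply/ltnW/(@pos_lt _ (cut b')). Qed.

(** In each way that [cyc b x y] arises by concatenation, one of four things holds: the images are
    ordered in the target cut, [x] follows [b] in its fiber and lifts to 0, [y] precedes [b] there
    and lifts to the top, or [x] and [y] share another fiber and have equal lifts. *)
Lemma lift_mono x y : cut_le b x y -> lift x <= lift y.
Proof.
case/or3P=> [/eqP->|/eqP->//|]; first by rewrite lift_base.
have lift0 u : fle f b u -> lift u = 0.
  by move=> bu; rewrite /lift /wraps bu andbF -(fle_fiber bu) fb cut_pos_base.
have liftT u : (u != b) && fle f u b -> lift u = #|V (ccarrier T)|.
  move=> /andP[ub u_le]; rewrite /lift /wraps (fle_fiber u_le) fb eqxx /=.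
  case: ifP => // /negbFE bu; case/eqP: ub.
  by apply: (@fle_anti _ _ _ f); rewrite u_le.
rewrite (cyc_concat f) /concat_cyc fb => /or4P[xy||| /or4P[|||]].
- have [bx _ yb] := cyc_neq xy.
  rewrite /lift /wraps (negbTE yb) eq_sym (negbTE bx) /=.
  by rewrite -(@le_pos _ (cut b')) /= /cut_le xy !orbT.
- by case/andP=> /andP[_ /lift0->].
- case/andP=> /andP[_ /fle_fiber xy]; rewrite eq_sym => xb.
  by rewrite /lift /wraps -xy (negbTE xb).
- by case/andP=> /liftT->; rewrite lift_ub.
- by case/andP=> /andP[_ /lift0->].
- by case/andP=> _ /liftT->; rewrite lift_ub.
- by case/andP=> /liftT->; rewrite lift_ub.
Qed.

(** Away from the fiber of [b] nothing wraps, and a fiber is ordered as in the cut. Over the base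
    point, the part before [b] is the one that wraps, so it comes first, and each part is ordered as
    in the cut. *)
Lemma fle_wraps x y :
  fle f x y = (f x == f y) && (if wraps x == wraps y then cut_le b x y else wraps x).
Proof.
case: (eqVneq (f x) (f y)) => [exy|nxy] /=; last first.
  by apply/negP => /fle_fiber e; rewrite e eqxx in nxy.
case: (eqVneq x y) => [->|nxy]; first by rewrite eqxx cut_le_refl fle_refl.
have anti u v : u != v -> ~~ (fle f u v && fle f v u).
  by move=> uv; apply: contraNN uv => /fle_anti->.
have tot := fle_total exy; have axy := anti _ _ nxy.
rewrite /wraps -exy /cut_le (negbTE nxy) /=; case: (eqVneq x b) => [xb|nxb].
  by subst x; rewrite fle_refl andbF fb eqxx /=; case: (fle f b y).
case: (eqVneq y b) => [yb|nyb].
  subst y; rewrite exy fb eqxx /= fle_refl eq_sym /=.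
  have := anti _ _ nxb; move: tot.
  by rewrite cyc_xyx; case: (fle f x b); case: (fle f b x).
have nbx : b != x by rewrite eq_sym.
rewrite (cyc_concat f) /concat_cyc -exy cyc_xyy -fb nbx nyb nxy eqxx /=.
rewrite !andbF /=.
case: (eqVneq (f x) (f b)) => [exb|nxfb] /=; last first.
  have -> : fle f b x = false.
    by apply/negP => /fle_fiber e; rewrite e eqxx in nxfb.
  have -> : fle f y b = false.
    by apply/negP => /fle_fiber e; rewrite -e exy eqxx in nxfb.
  by rewrite /= !andbF !orbF andbT.
have tbx := fle_total (esym exb); have tby := fle_total (etrans (esym exb) exy).
have abx := anti _ _ nxb; have aby := anti _ _ nyb.
(* Now [b], [x], [y] share one fiber; totality, antisymmetry and transitivity of its order leave a
   propositional check. *)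
move: (@fle_trans _ _ _ f x b y) (@fle_trans _ _ _ f y b x).
move: (@fle_trans _ _ _ f b x y) (@fle_trans _ _ _ f b y x).
move: (@fle_trans _ _ _ f x y b) (@fle_trans _ _ _ f y x b).
move: tot axy tbx tby abx aby.
case: (fle f x y); case: (fle f y x) => //= _ _; case: (fle f b x);
case: (fle f x b) => //= h; case: (fle f b y); case: (fle f y b) => //= _ _ _;
by intuition.
Qed.

End Lift.

(** No position equals [#|T|], so the lift shows which elements wrap and where every element goes;
    [fle_wraps] then recovers the fiber orders. *)
Lemma lift_inj (V : finite_sets) (S T : fincyc V) (b : V (ccarrier S))
    (b' : V (ccarrier T)) (f g : cyc_map S T) :
  f b = b' -> g b = b' -> lift b b' f =1 lift b b' g -> f = g.
Proof.
move=> fb gb e.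
have lt x (h : cyc_map S T) : pos (S := cut b') (h x) < #|V (ccarrier T)|.
  exact: (@pos_lt _ (cut b')).
have E x : f x = g x /\ wraps b b' f x = wraps b b' g x.
  have := e x; rewrite /lift.
  case: ifP => [wf|_]; case: ifP => [wg|_] h.
  - by case/andP: wf => /eqP-> _; case/andP: wg => /eqP-> _.
  - by have := lt x g; rewrite -h ltnn.
  - by have := lt x f; rewrite h ltnn.
  - by split=> //; apply: (@pos_inj _ (cut b')).
apply: cyc_map_eq; first by apply/funext => x; case: (E x).
apply/funext => x; apply/funext => y; rewrite (fle_wraps fb) (fle_wraps gb).
by have [-> ->] := E x; have [-> ->] := E y.
Qed.

Definition unwrap (n i : nat) := if i == n then 0 else i.

(* [i] is a position in the source and [i'] the lift of its image, so that
   [u i'] is the position of the image. *)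
Lemma pos_cyc_concat (n i j k i' j' k' : nat) :
  0 < n -> i' <= n -> j' <= n -> k' <= n ->
  (i <= j -> i' <= j') -> (j <= i -> j' <= i') ->
  (j <= k -> j' <= k') -> (k <= j -> k' <= j') ->
  (k <= i -> k' <= i') -> (i <= k -> i' <= k') ->
  let u := unwrap n in
  let lt i i' j j' := (i != j) && ((u i' == u j') &&
    (if (i' == n) == (j' == n) then i <= j else i' == n)) in
  pos_cyc i j k =
  [|| pos_cyc (u i') (u j') (u k'),
      lt i i' j j' && (u k' != u i'), lt j j' k k' && (u i' != u j'),
      lt k k' i i' && (u j' != u k'),
      lt i i' j j' && lt j j' k k', lt j j' k k' && lt k k' i i'
    | lt k k' i i' && lt i i' j j'].
Proof.
move=> n0 hi hj hk ij ji jk kj ki ik /=; rewrite /unwrap /pos_cyc.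
case: (ltngtP i j) ij ji => [ij|ji|e] h1 h2; case: (ltngtP j k) jk kj => [jk|kj|e2] h3 h4;
case: (ltngtP k i) ki ik => [ki|ik|e3] h5 h6 //=;
  case: (ltngtP i' n) hi => // hi _; case: (ltngtP j' n) hj => // hj _;
  case: (ltngtP k' n) hk => // hk _ /=; rewrite ?andbF ?andbT ?eqxx /=; lia.
Qed.

Lemma lift_surj (V : finite_sets) (S T : fincyc V) (b : V (ccarrier S))
    (b' : V (ccarrier T)) m n g :
  m.+1 = #|V (ccarrier S)| -> n.+1 = #|V (ccarrier T)| ->
  end_preserving m n g ->
  exists2 f : cyc_map S T, f b = b' &
    forall x, lift b b' f x = g (pos (S := cut b) x).
Proof.
move=> Sm Tn gP; have [g_homo g0 g1] := gP.
pose p (x : V (ccarrier S)) := pos (S := cut b) x.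
(* The extra point [n.+1] is folded back onto the base point, at position 0. *)
pose f x : V (ccarrier T) := at_pos (S := cut b') b' (unwrap n.+1 (g (p x))).
have g_ub i : g i <= n.+1 := end_preserving_ub i gP.
have pf x : pos (S := cut b') (f x) = unwrap n.+1 (g (p x)).
  apply: at_posK; rewrite -[X in _ < X]Tn /unwrap.
  by case: eqVneq => // ne; rewrite ltn_neqAle ne g_ub.
have pfE x y : (f x == f y) = (unwrap n.+1 (g (p x)) == unwrap n.+1 (g (p y))).
  by rewrite (@pos_eq _ (cut b')) !pf.
(* The fiber order that [fle_wraps] forces, with [x] wrapping exactly when [g (p x)] is [n.+1]. *)
pose r x y := (f x == f y) &&
  (if (g (p x) == n.+1) == (g (p y) == n.+1) then p x <= p y else g (p x) == n.+1).
have r_fib x y : r x y -> f x = f y by case/andP=> /eqP.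
have r_refl : reflexive r by move=> x; rewrite /r !eqxx leqnn.
have r_anti : antisymmetric r.
  move=> x y /andP[/andP[_ xy] /andP[_ yx]]; apply: (@pos_inj _ (cut b)).
  by apply/eqP; rewrite eqn_leq -!/(p _); move: xy yx;
    case: (g (p x) == _); case: (g (p y) == _) => //= -> ->.
have r_trans : transitive r.
  move=> y x z /andP[/eqP exy xy] /andP[/eqP eyz yz]; rewrite /r exy eyz eqxx /=.
  move: xy yz; case: (g (p x) == _); case: (g (p y) == _); case: (g (p z) == _) => //=;
  exact: leq_trans.
have r_total x y : f x = f y -> r x y || r y x.
  move=> e; rewrite /r e eqxx /=; case: (g (p x) == _); case: (g (p y) == _) => //=;
  exact: leq_total.
have cycE x y z : cyc x y z = concat_cyc (@cyc _ T) f r x y z.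
  rewrite (cyc_pos b) /concat_cyc (cyc_pos b') !pf !(@pos_eq _ (cut b)) /r !pfE.
  by rewrite -!/(p _); apply: pos_cyc_concat => //; apply: g_homo.
have pb : p b = 0 by apply: cut_pos_base.
have fb : f b = b'.
  by apply: (@pos_inj _ (cut b')); rewrite pf pb g0 cut_pos_base.
exists (CycMap r_fib r_refl r_anti r_trans r_total cycE) => //= x.
rewrite /lift /wraps /= pf /r -fb [f b == _]eq_sym !pfE pb g0 /= -Tn -/(p x) /unwrap.
by case: (eqVneq (g (p x)) n.+1) => [->|_] /=; rewrite ?andbT ?andbN ?if_same /=.
Qed.

(** * Coding of 0DeltaC *)

Section Delta0CCoding.
Variable V : finite_sets.
Implicit Types X Y Z : Delta0C_ob V.

Definition Delta0C_rank X := #|V (ccarrier (Delta0C_cyc X))|.-1.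

Lemma Delta0C_rankS X : (Delta0C_rank X).+1 = #|V (ccarrier (Delta0C_cyc X))|.
Proof. by rewrite /Delta0C_rank prednK // DeltaC_nonempty. Qed.

Definition Delta0C_enc X Y (f : Delta0C_hom X Y) (i : nat) : nat :=
  if i < #|V (ccarrier (Delta0C_cyc X))|
  then lift (base X) (base Y) (Delta0C_map f) (at_pos (S := cut (base X)) (base X) i)
  else #|V (ccarrier (Delta0C_cyc Y))|.

Lemma Delta0C_enc_pos X Y (f : Delta0C_hom X Y) x :
  Delta0C_enc f (pos (S := cut (base X)) x) = lift (base X) (base Y) (Delta0C_map f) x.
Proof. by rewrite /Delta0C_enc (@pos_lt _ (cut (base X))) pos_atK. Qed.

Lemma Delta0C_enc_card X Y (f : Delta0C_hom X Y) i :
  #|V (ccarrier (Delta0C_cyc X))| <= i ->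
  Delta0C_enc f i = #|V (ccarrier (Delta0C_cyc Y))|.
Proof. by rewrite /Delta0C_enc ltnNge => ->. Qed.

Lemma position_ind X (P : nat -> Prop) :
  (forall x, P (pos (S := cut (base X)) x)) ->
  (forall i, #|V (ccarrier (Delta0C_cyc X))| <= i -> P i) -> forall i, P i.
Proof.
move=> Px Pi i; case: (ltnP i #|V (ccarrier (Delta0C_cyc X))|) => [iX|/Pi//].
by have [x <-] := @pos_surj _ (cut (base X)) _ iX.
Qed.

Lemma Delta0C_enc_inj X Y : injective (@Delta0C_enc X Y).
Proof.
move=> f g e; apply: Delta0C_hom_eq.
apply: (lift_inj (Delta0C_base f) (Delta0C_base g)) => x.
by rewrite -!Delta0C_enc_pos e.
Qed.

Lemma Delta0C_encP X Y (f : Delta0C_hom X Y) :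
  end_preserving (Delta0C_rank X) (Delta0C_rank Y) (Delta0C_enc f).
Proof.
split=> [| |i Xi]; last by rewrite Delta0C_rankS Delta0C_enc_card -?Delta0C_rankS.
  elim/(@position_ind X) => [x|i iX]; elim/(@position_ind X) => [y|j jX] ij.
  - rewrite !Delta0C_enc_pos; apply: lift_mono; first exact: Delta0C_base.
    by rewrite -(@le_pos _ (cut (base X))) in ij.
  - by rewrite Delta0C_enc_pos Delta0C_enc_card // lift_ub.
  - by have := leq_trans iX ij; rewrite leqNgt (@pos_lt _ (cut (base X))).
  - by rewrite !Delta0C_enc_card.
rewrite -[X in Delta0C_enc f X](cut_pos_base (base X)) Delta0C_enc_pos lift_base //.
exact: Delta0C_base.
Qed.

Lemma Delta0C_enc_surj X Y g :
  end_preserving (Delta0C_rank X) (Delta0C_rank Y) g ->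
  exists f : Delta0C_hom X Y, Delta0C_enc f = g.
Proof.
move=> gP.
have [f fb fE] := lift_surj (base X) (base Y) (Delta0C_rankS X) (Delta0C_rankS Y) gP.
exists (@Delta0CHom _ X Y f fb); apply/funext; elim/(@position_ind X) => [x|i iX].
  by rewrite Delta0C_enc_pos fE.
case: gP => _ _ g1; rewrite Delta0C_enc_card // g1 ?Delta0C_rankS //.
Qed.

Lemma Delta0C_enc_id X : Delta0C_enc (Delta0C_id X) = minn^~ (Delta0C_rank X).+1.
Proof.
apply/funext; rewrite Delta0C_rankS; elim/(@position_ind X) => [x|i iX]; last first.
  by rewrite Delta0C_enc_card //; symmetry; apply/minn_idPr.
rewrite Delta0C_enc_pos (minn_idPl (ltnW (@pos_lt _ (cut (base X)) x))).
by rewrite /lift /wraps /= [_ == x]eq_sym andbN.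
Qed.

(** An element wraps under the composite either because it already wraps under [f], and then the
    code of [g] fixes the top, or because it does not and its image wraps under [g]. *)
Lemma Delta0C_enc_comp X Y Z (g : Delta0C_hom Y Z) (f : Delta0C_hom X Y) :
  Delta0C_enc (Delta0C_comp g f) = Delta0C_enc g \o Delta0C_enc f.
Proof.
apply/funext; elim/(@position_ind X) => [x|i iX] /=; last by rewrite !Delta0C_enc_card.
rewrite !Delta0C_enc_pos {2}/lift /wraps.
have fb := Delta0C_base f; have gb := Delta0C_base g.
case: (eqVneq (cyc_fun (Delta0C_map f) x) (base Y)) => [e|ne] /=; last first.
  by rewrite Delta0C_enc_pos /lift /wraps /= /comp_fle fb [base Y == _]eq_sym (negbTE ne).
case: ifP => /= [nb|b].
  by rewrite Delta0C_enc_card // /lift /wraps /= /comp_fle fb e gb !eqxx nb.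
rewrite Delta0C_enc_pos /lift /wraps /= /comp_fle fb e gb !eqxx b.
by rewrite fle_refl.
Qed.

Definition Delta0C_coding : coding (Delta0C V) :=
  @Coding (Delta0C V) Delta0C_rank Delta0C_enc Delta0C_enc_inj Delta0C_encP
    Delta0C_enc_surj Delta0C_enc_id Delta0C_enc_comp.

End Delta0CCoding.

(** * Pointed cyclic orders and nonempty linear orders *)

Section CyclicOfOrder.
Variables (V : finite_sets) (S : finord V).
Implicit Types x y z t : V (carrier S).

Definition order_cyc x y z := pos_cyc (pos x) (pos y) (pos z).

Lemma order_cyc_rot x y z : order_cyc x y z -> order_cyc y z x.
Proof. rewrite /order_cyc /pos_cyc; lia. Qed.

Lemma order_cyc_asym x y z : order_cyc x y z -> ~~ order_cyc x z y.
Proof. rewrite /order_cyc /pos_cyc; lia. Qed.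

Lemma order_cyc_trans x y z t : order_cyc x y z -> order_cyc x z t -> order_cyc x y t.
Proof. rewrite /order_cyc /pos_cyc; lia. Qed.

Lemma order_cyc_total x y z :
  x != y -> y != z -> z != x -> order_cyc x y z || order_cyc x z y.
Proof. rewrite !pos_eq /order_cyc /pos_cyc; lia. Qed.

Definition close_up : fincyc V :=
  FinCyc order_cyc_rot order_cyc_asym order_cyc_trans order_cyc_total.

End CyclicOfOrder.

Section ObjectBijection.
Variable V : finite_sets.

Lemma finord_eq (A : code V) (r s : rel (V A)) r1 r2 r3 r4 s1 s2 s3 s4 :
  r =2 s -> @FinOrd V A r r1 r2 r3 r4 = @FinOrd V A s s1 s2 s3 s4.
Proof.
move=> e; have {e}e : r = s by apply/funext => x; apply/funext => y.
by subst s; congr FinOrd; apply: Prop_irrelevance.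
Qed.

Lemma Delta0C_ob_eq (A : code V) (r s : V A -> V A -> V A -> bool)
    r1 r2 r3 r4 s1 s2 s3 s4 rA sA b :
  (forall x y z, r x y z = s x y z) ->
  @Delta0COb V (@DeltaCOb V (@FinCyc V A r r1 r2 r3 r4) rA) b =
  @Delta0COb V (@DeltaCOb V (@FinCyc V A s s1 s2 s3 s4) sA) b.
Proof.
move=> e; have {e}e : r = s.
  by apply/funext => x; apply/funext => y; apply/funext => z.
subst s; rewrite (Prop_irrelevance s1 r1) (Prop_irrelevance s2 r2).
rewrite (Prop_irrelevance s3 r3) (Prop_irrelevance s4 r4).
by rewrite (Prop_irrelevance sA rA).
Qed.

Lemma Delta_ob_inj : injective (@Delta_ord V).
Proof. by case=> S h [T k] /= e; subst T; congr DeltaOb; apply: Prop_irrelevance. Qed.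

Definition Delta_of_Delta0C (X : Delta0C_ob V) : Delta_ob V :=
  @DeltaOb V (cut (base X)) (DeltaC_nonempty (Delta0C_cyc X)).

Lemma Delta_bottom (S : Delta_ob V) : exists x : V (carrier S), pos x = 0.
Proof. exact/pos_surj/Delta_nonempty. Qed.

Definition Delta0C_of_Delta (S : Delta_ob V) : Delta0C_ob V :=
  @Delta0COb V (@DeltaCOb V (close_up S) (Delta_nonempty S))
    (sval (cid (Delta_bottom S))).

Lemma Delta0C_of_DeltaK : cancel Delta0C_of_Delta Delta_of_Delta0C.
Proof.
move=> S; apply: Delta_ob_inj; rewrite /= /cut; case: cid => b /= b0.
(* As [b] has position 0, [pos_cyc] from [b] reduces to comparing two positive positions. *)
have E x y : cut_le (S := close_up S) b x y = le x y.
  rewrite /cut_le /= /order_cyc /pos_cyc le_pos !pos_eq b0; lia.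
by case: S b {b0} E => -[A r r1 r2 r3 r4] /= h b E; apply: finord_eq.
Qed.

(** The element at position 0 of the cut is the base point, and by [cyc_pos] closing up the cut
    restores the cyclic order. *)
Lemma Delta_of_Delta0CK : cancel Delta_of_Delta0C Delta0C_of_Delta.
Proof.
case=> -[S h] b; rewrite /Delta0C_of_Delta /=; case: cid => b1 /= b10.
have {b10}e : b1 = b by apply: (@pos_inj _ (cut b)); rewrite b10 cut_pos_base.
subst b1; have /= := cyc_pos b; move: b => /= b.
case: S b h => A r r1 r2 r3 r4 b h /= E; apply: Delta0C_ob_eq => x y z.
by rewrite E.
Qed.

End ObjectBijection.

Lemma Delta0C_isomorphic (V : finite_sets) : isomorphic (Delta0C V) (op (Delta V)).
Proof.
exact: (coded_isomorphic (c := Delta0C_coding V) (d := Delta_coding V)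
  (@Delta_of_Delta0CK V) (@Delta0C_of_DeltaK V)).
Qed.

Lemma Delta0C_equivalent (V : finite_sets) : equivalent (Delta0C V) (op (Delta V)).
Proof.
apply: (coded_equivalent (c := Delta0C_coding V) (d := Delta_coding V)
  (phi := @Delta_of_Delta0C V) (psi := @Delta0C_of_Delta V)) => //.
Qed.

(** * Standard objects and the equivalence for 01Delta *)

Section StandardObjects.
Variable n : nat.

Definition ordinal_finord : finord all_finite_sets :=
  @FinOrd all_finite_sets 'I_n.+1 (fun i j => i <= j)
    (fun i => leqnn i) (fun i j ij => val_inj (anti_leq ij))
    (fun j i k => @leq_trans j i k) (fun i j => leq_total i j).

Lemma ordinal_nonempty : 0 < #|all_finite_sets (carrier ordinal_finord)|.
Proof. by rewrite card_ord. Qed.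

Definition ordinal_Delta : Delta_ob all_finite_sets := DeltaOb ordinal_nonempty.

End StandardObjects.

Section StandardPointedObjects.
Variable n : nat.

Lemma ordinal_ends_neq : (ord0 : 'I_n.+2) <> ord_max.
Proof. by move/(congr1 val). Qed.

Definition ordinal_Delta01 : Delta01_ob all_finite_sets :=
  @Delta01Ob all_finite_sets (ordinal_finord n.+1) ord0 ord_max
    (fun i => leq0n i) (fun i => leq_ord i) ordinal_ends_neq.

End StandardPointedObjects.

(** Only ranks have to match, so every object may be sent to a standard one: rank [n] means [n+2]
    elements in 01Delta and [n+1] in Delta. *)
Lemma Delta01_equivalent :
  equivalent (Delta01 all_finite_sets) (op (Delta all_finite_sets)).
Proof.
apply: (coded_equivalent (c := Delta01_coding _) (d := Delta_coding _)
  (phi := fun X => ordinal_Delta (Delta01_rank X))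
  (psi := fun Y => ordinal_Delta01 (Delta_rank Y))) => X /=.
  by rewrite /Delta_rank card_ord.
by rewrite /Delta01_rank card_ord.
Qed.

(** * Hessenberg's theorem *)

Section Hessenberg.
Local Open Scope classical_set_scope.
Variable U : choiceType.
Implicit Types (A B : set U) (x y z : U).

Definition embeds A B :=
  exists2 f : U -> U, (forall x, A x -> B (f x)) &
    (forall x y, A x -> A y -> f x = f y -> x = y).

(** Zorn's lemma gives a maximal graph of a partial bijection from [A] to [B]. It covers [A] or [B],
    since otherwise a pair of uncovered points could be added. *)
Lemma embeds_total A B : embeds A B \/ embeds B A.
Proof.
pose P (G : set (U * U)) := (forall p, G p -> A p.1 /\ B p.2) /\
  (forall p q, G p -> G q -> p.1 = q.1 <-> p.2 = q.2).
have [F FP totF|G [[GAB Ginj] Gmax]] := @Zorn_bigcup _ P.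
  split=> [p [X FX Xp]|p q [X FX Xp] [Y FY Yq]]; first exact: (FP X FX).1.
  have [XY|YX] := totF X Y FX FY.
    by apply: (FP Y FY).2 => //; apply: XY.
  by apply: (FP X FX).2 => //; apply: YX.
have [Acov|/existsNP[a /not_implyP[Aa aG]]] :=
    pselect (forall a, A a -> exists b, G (a, b)).
  left; pose f a := xget a [set b | G (a, b)].
  have fG a : A a -> G (a, f a)
    by move=> /Acov[b Gb]; apply: (@xgetI _ a [set b | G (a, b)] b).
  exists f => [a /fG/GAB[]//|a a' Aa Aa'].
  by have := Ginj _ _ (fG a Aa) (fG a' Aa') => /= ->.
have [Bcov|/existsNP[b /not_implyP[Bb bG]]] :=
    pselect (forall b, B b -> exists a, G (a, b)).
  right; pose f b := xget b [set a | G (a, b)].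
  have fG b : B b -> G (f b, b)
    by move=> /Bcov[c Gc]; apply: (@xgetI _ b [set a | G (a, b)] c).
  exists f => [b /fG/GAB[]//|b b' Bb Bb'].
  by have := Ginj _ _ (fG b Bb) (fG b' Bb') => /= ->.
exfalso; apply: (Gmax (G `|` [set (a, b)])).
  split=> [p Gp|]; first by left.
  by move=> /(_ (a, b)) H; apply: aG; exists b; apply: H; right.
split=> [p [/GAB//|->//]|p q [Gp|->] [Gq|->]] //=; first exact: Ginj.
- split=> e; case: p Gp e => p1 p2 /= Gp e; subst.
    by case: aG; exists p2.
  by case: bG; exists p1.
- split=> e; case: q Gq e => q1 q2 /= Gq e; subst.
    by case: aG; exists q2.
  by case: bG; exists q1.
Qed.

Definition pairing_dom (G : set (U * U * U)) : set U := [set x | exists z, G (x, x, z)].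

(* G is the graph of an injection A * A -> A, with A recovered as
   [pairing_dom G]. *)
Definition is_pairing (G : set (U * U * U)) :=
  [/\ forall x y z, G (x, y, z) ->
        [/\ pairing_dom G x, pairing_dom G y & pairing_dom G z],
      forall x y, pairing_dom G x -> pairing_dom G y -> exists z, G (x, y, z)
    & forall p q, G p -> G q -> p.1 = q.1 <-> p.2 = q.2].

Lemma is_pairing_bigcup (F : set (set (U * U * U))) :
  F `<=` is_pairing -> total_on F subset -> is_pairing (\bigcup_(X in F) X).
Proof.
move=> FP totF.
have dom_sub X : F X -> pairing_dom X `<=` pairing_dom (\bigcup_(X in F) X).
  by move=> FX x [z Xz]; exists z; exists X.
have total2 X Y : F X -> F Y -> exists2 Z, F Z & X `<=` Z /\ Y `<=` Z.
  by move=> FX FY; have [?|?] := totF X Y FX FY; [exists Y|exists X] => //; split.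
split=> [x y z [X FX Xxyz]|x y [z [X FX Xz]] [t [Y FY Yt]]|p q [X FX Xp] [Y FY Yq]].
- have [PX _ _] := FP X FX; have [? ? ?] := PX x y z Xxyz.
  by split; apply: dom_sub FX _ _.
- have [Z FZ [XZ YZ]] := total2 X Y FX FY; have [_ PZ _] := FP Z FZ.
  have [||w Zw] := PZ x y; [by exists z; apply: XZ | by exists t; apply: YZ|].
  by exists w; exists Z.
- have [Z FZ [XZ YZ]] := total2 X Y FX FY; have [_ _ PZ] := FP Z FZ.
  exact: PZ p q (XZ _ Xp) (YZ _ Yq).
Qed.

Definition pairing_into A B (p : U -> U -> U) :=
  (forall x y, A x -> A y -> B (p x y)) /\
  (forall x y x' y', A x -> A y -> A x' -> A y' ->
     p x y = p x' y' -> x = x' /\ y = y').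

Lemma is_pairing_fun G : is_pairing G -> exists2 f : U -> U -> U,
  pairing_into (pairing_dom G) (pairing_dom G) f &
  forall x y, pairing_dom G x -> pairing_dom G y -> G (x, y, f x y).
Proof.
move=> [G1 G2 G3]; pose f x y := xget x [set z | G (x, y, z)].
have fG x y : pairing_dom G x -> pairing_dom G y -> G (x, y, f x y).
  move=> Ax Ay; have [z Gz] := G2 x y Ax Ay.
  exact: (@xgetI _ x [set z | G (x, y, z)] z).
exists f => //; split=> [x y Ax Ay|x y x' y' Ax Ay Ax' Ay' e].
  by have [] := G1 _ _ _ (fG x y Ax Ay).
by have [_ /(_ e)[]] := G3 _ _ (fG x y Ax Ay) (fG x' y' Ax' Ay').
Qed.

(* A' embeds into two disjoint copies of A, hence into A * A. *)
Lemma pairing_widen A A' (f : U -> U -> U) (a0 a1 : U) :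
  pairing_into A A f -> A a0 -> A a1 -> a0 <> a1 -> embeds (A' `\` A) A ->
  exists p, pairing_into A' A p.
Proof.
move=> [fA f_inj] A0 A1 a01 [h hA h_inj].
pose u x := if `[< A x >] then f a0 x else f a1 (h x).
have uA x : A' x -> A (u x).
  by rewrite /u => A'x; case: asboolP => Ax; apply: fA => //; apply: hA.
have u_inj x y : A' x -> A' y -> u x = u y -> x = y.
  have hA' z : A' z -> ~ A z -> A (h z) by move=> A'z nAz; apply: hA.
  move=> A'x A'y; rewrite /u; case: asboolP => Ax; case: asboolP => Ay;
    move=> /f_inj[]; auto => // e; try by case: a01; rewrite e.
  by apply: h_inj.
exists (fun x y => f (u x) (u y)); split=> [x y A'x A'y|x y x' y' A'x A'y A'x' A'y'].
  by apply: fA; apply: uA.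
move=> /f_inj[]; try exact: uA.
by move=> /u_inj-> // /u_inj->.
Qed.

(** The copy [B] of [A] is disjoint from [A]. By [pairing_widen], pairs from the union inject into
    [A], and [k] carries these values to [B], so new pairs never collide with the values of [G]. *)
Lemma is_pairing_extend (G : set (U * U * U)) (a0 a1 : U) :
  is_pairing G -> pairing_dom G a0 -> pairing_dom G a1 -> a0 <> a1 ->
  embeds (pairing_dom G) (~` pairing_dom G) ->
  exists2 G', is_pairing G' & G `<` G'.
Proof.
move=> GP A0 A1 a01 [k kA k_inj].
have [f f_pair fG] := is_pairing_fun GP; have [G1 _ G3] := GP.
set A := pairing_dom G in f_pair fG kA k_inj A0 A1; pose B := k @` A.
pose k' x := xget x [set a | A a /\ k a = x].
have k'P x : B x -> A (k' x) /\ k (k' x) = x.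
  by move=> [a Aa ka]; apply: (@xgetI _ x [set a | A a /\ k a = x] a).
have BnA x : B x -> ~ A x by move=> [a Aa <-]; apply: kA.
pose A' := A `|` B.
have [|p [pA p_inj]] := pairing_widen (A' := A') f_pair A0 A1 a01.
  have A'B x : (A' `\` A) x -> B x by move=> [[]].
  exists k' => [x /A'B/k'P[]//|x y /A'B/k'P[_ kx] /A'B/k'P[_ ky] e].
  by rewrite -kx -ky e.
pose N : set (U * U * U) := [set t | [/\ A' t.1.1, A' t.1.2, ~ (A t.1.1 /\ A t.1.2)
  & t.2 = k (p t.1.1 t.1.2)]].
have domE x : pairing_dom (G `|` N) x <-> A' x.
  split=> [[z [Gz|[]//]]|A'x]; first by left; exists z.
  have [[z Gz]|nAx] := pselect (A x); first by exists z; left.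
  by exists (k (p x x)); right; split=> //= -[].
have NB t : N t -> B t.2 by move=> [? ? ? ->]; exists (p t.1.1 t.1.2) => //; apply: pA.
have GA t : G t -> [/\ A t.1.1, A t.1.2 & A t.2] by case: t => -[x y] z /G1.
exists (G `|` N); last first.
  (* The extension is strict because the pair of [k a0] with itself is new. *)
  split=> [t Gt|sub]; first by left.
  have Ba : B (k a0) by exists a0.
  apply: (BnA _ Ba); have [|] // := GA (k a0, k a0, k (p (k a0) (k a0))).
  apply: sub; right; split=> //=; [by right|by right|].
  by case=> /(BnA _ Ba).
split=> [x y z GN|x y /domE A'x /domE A'y|q r].
- case: GN => [Gt|Nt].
    by have [? ? ?] := GA _ Gt; split; apply/domE; left.
  have Bz := NB _ Nt; case: Nt => /= ? ? _ _.
  by split; apply/domE => //; right.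
- have [[Ax Ay]|nA] := pselect (A x /\ A y).
    by exists (f x y); left; apply: fG.
  by exists (k (p x y)); right.
- move=> [Gq|Nq] [Gr|Nr].
  + exact: G3.
  + have [q1 q2 q3] := GA q Gq; have Br := NB r Nr; case: Nr => _ _ nr _.
    split=> e; first by case: nr; rewrite -e.
    by case: (BnA _ Br); rewrite -e.
  + have [r1 r2 r3] := GA r Gr; have Bq := NB q Nq; case: Nq => _ _ nq _.
    split=> e; first by case: nq; rewrite e.
    by case: (BnA _ Bq); rewrite e.
  + case: Nq => q1 q2 _ qE; case: Nr => r1 r2 _ rE; rewrite qE rE.
    split=> [->//|/k_inj e].
    have [|e1 e2] := p_inj _ _ _ _ q1 q2 r1 r2; first by apply: e; apply: pA.
    by case: q r {qE rE e q1 q2 r1 r2} e1 e2 => -[x y] z [[x' y'] z'] /= -> ->.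
Qed.

Lemma infinite_sequence : infinite_set [set: U] -> exists e : nat -> U, injective e.
Proof.
move=> /infiniteP/card_leP[e].
exists (fun n => val (e (SigSub (mem_set (I : [set: nat] n))))) => m n /val_inj emn.
have := @inj _ _ _ e _ _ _ _ emn; rewrite !in_setT => /(_ isT isT).
by move=> /(congr1 val).
Qed.

(** Start from a pairing on a countable subset and take a maximal one. By [is_pairing_extend] its
    domain does not embed into the complement, so the complement embeds into the domain and
    [pairing_widen] reaches all of [U]. *)
Lemma infinite_pairing : infinite_set [set: U] ->
  exists p : U -> U -> U, forall x y x' y', p x y = p x' y' -> x = x' /\ y = y'.
Proof.
move=> /infinite_sequence[e e_inj].
pose G0 : set (U * U * U) :=
  [set t | exists i j, t = (e i, e j, e (choice.pickle (i, j)))].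
have G0dom i : pairing_dom G0 (e i).
  by exists (e (choice.pickle (i, i))), i, i.
have G0P : is_pairing G0.
  split=> [x y z [i [j [-> -> ->]]] //|x y [_ [i [_ [-> _ _]]]] [_ [j [_ [-> _ _]]]]|].
    by exists (e (choice.pickle (i, j))), i, j.
  move=> _ _ [i [j ->]] [i' [j' ->]] /=; split=> [[/e_inj-> /e_inj->]//|].
  by move=> /e_inj/(pcan_inj choice.pickleK)[-> ->].
(* Only nonempty pairings must contain [G0], so that the empty union, coming from the empty chain,
   satisfies [P]. *)
pose P G := is_pairing G /\ (G !=set0 -> G0 `<=` G).
have [F FP totF|G [[GP G0G] Gmax]] := @Zorn_bigcup _ P.
  split; first by apply: is_pairing_bigcup totF => X /FP[].
  move=> [t [X FX Xt]]; apply: (@subset_trans _ X); last by move=> s Xs; exists X.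
  by have [_] := FP X FX; apply; exists t.
(* A maximal [G] is nonempty, since [G0] strictly contains the empty pairing. *)
have {}G0G : G0 `<=` G.
  have [/G0G//|G0_empty] := pselect (G !=set0); exfalso.
  apply: (Gmax G0); last by split=> // _.
  split=> [t Gt|/(_ (e 0, e 0, e (choice.pickle (0, 0))))]; first by case: G0_empty; exists t.
  by move=> H; apply: G0_empty; eexists; apply: H; exists 0, 0; reflexivity.
have Gdom i : pairing_dom G (e i) by have [z /G0G Gz] := G0dom i; exists z.
have e01 : e 0 <> e 1 by move/e_inj.
have GN0 : G !=set0 by have [z Gz] := Gdom 0; exists (e 0, e 0, z).
have [h|[h hA h_inj]] := embeds_total (pairing_dom G) (~` pairing_dom G).
  have [G' G'P GG'] := is_pairing_extend GP (Gdom 0) (Gdom 1) e01 h.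
  case: (Gmax G' GG'); split=> // _; apply: subset_trans G0G _; exact: GG'.1.
have [f f_pair _] := is_pairing_fun GP.
have [|p [_ p_inj]] := pairing_widen (A' := setT) f_pair (Gdom 0) (Gdom 1) e01.
  by rewrite setTD; exists h.
by exists p => x y x' y'; apply: p_inj.
Qed.

End Hessenberg.

(** * Gluing bijections between sets of equal rank *)

Section RankBijection.
Local Open Scope classical_set_scope.
Local Open Scope card_scope.

Lemma rank_bijection (T1 T2 : Type) (r1 : T1 -> nat) (r2 : T2 -> nat) :
  (forall n, [set x | r1 x = n] #= [set y | r2 y = n]) ->
  exists (phi : T1 -> T2) (psi : T2 -> T1),
    [/\ cancel phi psi, cancel psi phi & forall x, r2 (phi x) = r1 x].
Proof.
move=> eq_card.
have ex n : exists fg : ([set x | r1 x = n] -> [set y | r2 y = n]) *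
    ([set y | r2 y = n] -> [set x | r1 x = n]), cancel fg.1 fg.2 /\ cancel fg.2 fg.1.
  by have /card_bijP[f [g fK gK]] := eq_card n; exists (f, g).
pose f n := sval (cid (ex n)); have fP n := svalP (cid (ex n)).
(* Keeping [n] apart from [r1 x] lets [phi] and [psi] use the same bijection [f n]; [psiE] and
   [phiE] later exchange the index for the actual rank. *)
pose phi n x (xn : r1 x = n) : T2 :=
  val ((f n).1 (SigSub (mem_set (xn : [set x | r1 x = n] x)))).
pose psi n y (yn : r2 y = n) : T1 :=
  val ((f n).2 (SigSub (mem_set (yn : [set y | r2 y = n] y)))).
have phi_rank n x (xn : r1 x = n) : r2 (phi n x xn) = n.
  by rewrite /phi; case: ((f n).1 _) => y /= /set_mem.
have psi_rank n y (yn : r2 y = n) : r1 (psi n y yn) = n.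
  by rewrite /psi; case: ((f n).2 _) => y' /= /set_mem.
have phiK n x (xn : r1 x = n) yn : psi n (phi n x xn) yn = x.
  rewrite /psi; set u := SigSub _.
  have -> : u = (f n).1 (SigSub (mem_set (xn : [set x | r1 x = n] x))) by apply: val_inj.
  exact: (congr1 val ((fP n).1 _)).
have psiK n y (yn : r2 y = n) xn : phi n (psi n y yn) xn = y.
  rewrite /phi; set u := SigSub _.
  have -> : u = (f n).2 (SigSub (mem_set (yn : [set y | r2 y = n] y))) by apply: val_inj.
  exact: (congr1 val ((fP n).2 _)).
have psiE n y (yn : r2 y = n) : psi (r2 y) y erefl = psi n y yn by subst n.
have phiE n x (xn : r1 x = n) : phi (r1 x) x erefl = phi n x xn by subst n.
exists (fun x => phi (r1 x) x erefl), (fun y => psi (r2 y) y erefl); split=> [x|y|x] //.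
  by rewrite (psiE _ _ (phi_rank _ x erefl)) phiK.
by rewrite (phiE _ _ (psi_rank _ y erefl)) psiK.
Qed.

End RankBijection.

(** * Linearly ordered finite subsets of an infinite set *)

Section FiniteSubsets.
Local Open Scope classical_set_scope.
Local Open Scope card_scope.
Variable U : choiceType.
Local Notation V := (finite_subsets U).

Definition order_list (S : finord V) : seq (V (carrier S)) :=
  sort (@le V S) (enum (V (carrier S))).

Lemma order_list_sorted S : sorted (@le V S) (order_list S).
Proof. exact/sort_sorted/le_total. Qed.

Lemma mem_order_list S x : x \in order_list S.
Proof. by rewrite mem_sort mem_enum. Qed.

Lemma order_list_uniq S : uniq (order_list S).
Proof. by rewrite sort_uniq enum_uniq. Qed.

Lemma le_order_list S (x y : V (carrier S)) :
  le x y = (index x (order_list S) <= index y (order_list S)).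
Proof.
have idx := sorted_leq_index (@le_trans V S) (@le_refl V S) (order_list_sorted S).
apply/idP/idP => [xy|]; last by apply: idx; apply: mem_order_list.
rewrite leqNgt; apply/negP => yx.
have e : x = y.
  apply: (@le_anti V S); rewrite xy; apply: idx (ltnW yx); exact: mem_order_list.
by rewrite e ltnn in yx.
Qed.

(** A linear order on a finite subset of [U] amounts to a duplicate-free sequence, whose type does
    not depend on the carrier. *)
Definition order_seq (S : finord V) : seq U := map val (order_list S).

Lemma order_seq_uniq S : uniq (order_seq S).
Proof. by rewrite map_inj_uniq ?order_list_uniq //; apply: val_inj. Qed.

Lemma size_order_seq S : size (order_seq S) = #|V (carrier S)|.
Proof. by rewrite size_map size_sort -cardE. Qed.

Lemma mem_order_seq S a : (a \in order_seq S) = (a \in (carrier S : {fset U})).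
Proof.
apply/mapP/idP => [[x _ ->]|aS]; first exact: valP.
by exists [` aS]%fset => //; apply: mem_order_list.
Qed.

(** The members of the sequence give the carrier and comparison of indices gives the order. *)
Lemma order_seq_inj : injective order_seq.
Proof.
move=> S T e; have : carrier S = carrier T.
  by apply/fsetP => a; rewrite -!mem_order_seq e.
have leS := @le_order_list S; have leT := @le_order_list T.
move: leS leT e; rewrite /order_seq; move: (order_list S) (order_list T).
case: S => A r r1 r2 r3 r4; case: T => B s s1 s2 s3 s4 /= l l' leS leT e eAB.
subst B; have {e}e := inj_map val_inj e; subst l'.
by apply: finord_eq => x y; rewrite leS leT.
Qed.

(** Order the members of [s] by index. Then [s] and the sequence obtained are both sorted by index
    and have the same members. *)
Lemma order_seq_surj (s : seq U) : uniq s -> exists S, order_seq S = s.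
Proof.
move=> s_uniq.
pose A : {fset U} := [fset x in s]%fset; pose r (a b : U) := index a s <= index b s.
have As (x : A) : val x \in s by have := valP x; rewrite in_fset.
have r_anti : antisymmetric (fun x y : A => r (val x) (val y)).
  move=> x y /anti_leq e; apply: val_inj.
  by rewrite -(nth_index (val x) (As x)) e nth_index.
pose S : finord V := @FinOrd V A (fun x y : A => r (val x) (val y))
  (fun x => leqnn _) r_anti (fun x y z => @leq_trans _ _ _) (fun x y => leq_total _ _).
exists S; apply: (@sorted_eq_in _ r).
- by move=> a b c _ _ _; apply: leq_trans.
- move=> a b aS bS /anti_leq e.
  have As' c : c \in order_seq S -> c \in s by rewrite mem_order_seq in_fset.
  by rewrite -(nth_index a (As' a aS)) e nth_index ?As'.
- by rewrite sorted_map; apply: order_list_sorted.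
- case es: {1}s => [//|a s']; rewrite -es; apply/(sortedP a) => i i_s.
  by rewrite /r !index_uniq // ltnW.
- apply: uniq_perm; rewrite ?order_seq_uniq // => a.
  by rewrite mem_order_seq in_fset.
Qed.

(* The types of objects are too large to form [set]s over them; comparing
   cardinals of sets of sequences instead keeps the universes small. *)
Definition is_long_seq k (s : seq U) := uniq s && (k <= size s).

Definition long_seq k := {s | is_long_seq k s}.

Lemma order_seq_long k (S : finord V) :
  k <= #|V (carrier S)| -> is_long_seq k (order_seq S).
Proof. by rewrite /is_long_seq order_seq_uniq size_order_seq. Qed.

Definition seq_of_Delta (X : Delta_ob V) : long_seq 1 :=
  Sub _ (order_seq_long (Delta_nonempty X)).

Lemma seq_of_Delta_inj : injective seq_of_Delta.
Proof. by move=> X Y /(congr1 val)/order_seq_inj/Delta_ob_inj. Qed.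

Lemma seq_of_Delta_surj s : exists X, seq_of_Delta X = s.
Proof.
case: s => s sP; have /andP[s_uniq s0] := sP.
have [S Ss] := order_seq_surj s_uniq; rewrite -Ss size_order_seq in s0.
by exists (DeltaOb s0); apply: val_inj.
Qed.

Lemma size_seq_of_Delta X : size (val (seq_of_Delta X)) = (Delta_rank X).+1.
Proof. by rewrite size_order_seq Delta_rankS. Qed.

Lemma Delta01_ob_exists (S : finord V) :
  1 < #|V (carrier S)| -> exists X : Delta01_ob V, Delta01_ord X = S.
Proof.
move=> S1; have [x0 x00] := pos_surj (ltnW S1).
have lt : #|V (carrier S)|.-1 < #|V (carrier S)| by rewrite prednK // ltnW.
have [x1 x11] := pos_surj lt.
have x0_min x : le x0 x by rewrite le_pos x00.
have x1_max x : le x x1 by rewrite le_pos x11 -ltnS prednK ?pos_lt // ltnW.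
have x01 : x0 <> x1 by move=> e; move: x11 S1; rewrite -e x00; case: #|_| => [|[]].
by exists (Delta01Ob x0_min x1_max x01).
Qed.

Lemma Delta01_ord_inj : injective (@Delta01_ord V).
Proof.
case=> S x0 x1 x0_min x1_max x01 [T y0 y1 y0_min y1_max y01] /= e; subst T.
have e : x0 = y0 by apply: le_anti; rewrite x0_min y0_min.
subst y0; have e : x1 = y1 by apply: le_anti; rewrite x1_max y1_max.
by subst y1; congr Delta01Ob; apply: Prop_irrelevance.
Qed.

Lemma Delta01_card (X : Delta01_ob V) : 1 < #|V (carrier X)|.
Proof. by rewrite -Delta01_rankSS. Qed.

Definition seq_of_Delta01 (X : Delta01_ob V) : long_seq 2 :=
  Sub _ (order_seq_long (Delta01_card X)).

Lemma seq_of_Delta01_inj : injective seq_of_Delta01.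
Proof. by move=> X Y /(congr1 val)/order_seq_inj/Delta01_ord_inj. Qed.

Lemma seq_of_Delta01_surj s : exists X, seq_of_Delta01 X = s.
Proof.
case: s => s sP; have /andP[s_uniq s1] := sP.
have [S Ss] := order_seq_surj s_uniq; rewrite -Ss size_order_seq in s1.
have [X XS] := Delta01_ob_exists s1.
by exists X; apply: val_inj; rewrite /= XS.
Qed.

Lemma size_seq_of_Delta01 X : size (val (seq_of_Delta01 X)) = (Delta01_rank X).+2.
Proof. by rewrite size_order_seq Delta01_rankSS. Qed.

Hypothesis Uinf : infinite_set [set: U].

Lemma fresh (s : seq U) : exists x, x \notin s.
Proof.
apply: contrapT => /forallNP H; apply: Uinf; apply/finite_seqP; exists s.
by apply/seteqP; split=> // x _ /=; apply/negPn/negP; apply: H.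
Qed.

Lemma fresh_seq k (x : U) : exists t, size t = k /\ uniq (x :: t).
Proof.
elim: k => [|k [t [tk xt]]]; first by exists [::].
have [y yxt] := fresh (x :: t); exists (y :: t); rewrite /= tk; split=> //.
move: yxt xt; rewrite !inE negb_or => /andP[yx yt] /= /andP[xt ->].
by rewrite negb_or eq_sym yx xt yt.
Qed.

(** Folding the pairing loses the length, but for a given length it can be undone one entry at a
    time. *)
Lemma seq_code : exists c : seq U -> U, forall s t, size s = size t -> c s = c t -> s = t.
Proof.
have [p p_inj] := infinite_pairing Uinf; have [x0 _] := infinite_setN0 Uinf.
exists (foldr p x0); elim=> [|a s IHs] [|b t] //= [st] /p_inj[-> /(IHs _ st)->].
by [].
Qed.

Lemma inj_card_leq (T T' : Type) (A : set T) (B : set T') (f : T -> T') :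
  (forall x, A x -> B (f x)) -> (forall x y, A x -> A y -> f x = f y -> x = y) ->
  A #<= B.
Proof.
move=> fAB f_inj; have [g] : $|{injfun A >-> B}|.
  apply/injfunPex; exists f => // x y /set_mem Ax /set_mem Ay; exact: f_inj.
exact: inj_card_le g.
Qed.

(** From [n+1] entries to [n]: code the whole sequence as one element and pad it with [n-1] fresh
    ones. Conversely, prepend a fresh element. For [n = 0] the length bounds make both sides
    empty. *)
Lemma long_seq_card n : [set s : long_seq 2 | (size (val s)).-1 = n] #=
  [set s : long_seq 1 | size (val s) = n].
Proof.
apply: Cantor_Bernstein.
  have [c c_inj] := seq_code; have /choice[ext extP] := fresh_seq n.-1.
  have ext_uniq (s : long_seq 2) : 
      is_long_seq 1 (c (val s) :: ext (c (val s))).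
    by rewrite /is_long_seq; have [_] /= := extP (c (val s)); rewrite andbT.
  apply: (@inj_card_leq _ _ _ _ (fun s => Sub _ (ext_uniq s) : long_seq 1)).
    move=> [s /= /andP[_ s1]] sn; have [-> _] := extP (c s); lia.
  move=> [s /= sP] [t /= tP] sn tn /(congr1 val)[/c_inj st _].
  apply/val_inj/st => /=; case/andP: sP => _; case/andP: tP => _; lia.
have /choice[fr frP] := fresh.
have fr_uniq (s : long_seq 1) : is_long_seq 2 (fr (val s) :: val s).
  by case: s => s /= /andP[s_uniq s0]; rewrite /is_long_seq /= frP s_uniq.
apply: (@inj_card_leq _ _ _ _ (fun s => Sub _ (fr_uniq s) : long_seq 2)) => //.
by move=> s t _ _ /(congr1 val)[_ /val_inj].
Qed.

Lemma Delta01_isomorphic : isomorphic (Delta01 V) (op (Delta V)).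
Proof.
have [phi [psi [phiK psiK phi_size]]] := rank_bijection long_seq_card.
pose f X := sval (cid (seq_of_Delta_surj (phi (seq_of_Delta01 X)))).
have fE X : seq_of_Delta (f X) = phi (seq_of_Delta01 X) by rewrite /f; case: cid.
pose g Y := sval (cid (seq_of_Delta01_surj (psi (seq_of_Delta Y)))).
have gE Y : seq_of_Delta01 (g Y) = psi (seq_of_Delta Y) by rewrite /g; case: cid.
apply: (@coded_isomorphic _ _ (Delta01_coding V) (Delta_coding V) f g).
- by move=> X; apply: seq_of_Delta01_inj; rewrite gE fE phiK.
- by move=> Y; apply: seq_of_Delta_inj; rewrite fE gE psiK.
- move=> X; apply: succn_inj.
  by rewrite -size_seq_of_Delta fE phi_size size_seq_of_Delta01.
Qed.

End FiniteSubsets.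

Theorem lemma3p3 :
  (forall U : choiceType, infinite_set [set: U]%classic ->
    isomorphic (Delta01 (finite_subsets U)) (op (Delta (finite_subsets U))) /\
    isomorphic (Delta0C (finite_subsets U)) (op (Delta (finite_subsets U)))) /\
  (equivalent (Delta01 all_finite_sets) (op (Delta all_finite_sets)) /\
   equivalent (Delta0C all_finite_sets) (op (Delta all_finite_sets))).
Proof.
split; [move=> U Uinf|]; split.
- exact: Delta01_isomorphic.
- exact: Delta0C_isomorphic.
- exact: Delta01_equivalent.
- exact: Delta0C_equivalent.
Qed.
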